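(* Let $G$ be a connected maximal nontraceable graph of order $n\ge 7$ which has no vertex of degree $1$ and no two adjacent vertices both of degree $2$. If $G$ has exactly $m$ vertices of degree $2$, then $e(G)\ge \tfrac12(3n+m)$.
   Context: Graphs are simple and finite; $e(G)$ is the number of edges. A graph is traceable if it has a hamiltonian path. A graph $G$ is maximal nontraceable if $G$ is not traceable but $G+e$ is traceable for every pair of nonadjacent vertices joined by a new edge $e$. *)

(* Defs.v *)
From mathcomp Require Import all_boot all_order all_algebra.

Set Implicit Arguments.
Unset Strict Implicit.
Unset Printing Implicit Defensive.

Section Graphs.
Variable T : finType.
Implicit Types (e : rel T) (x y u v : T).

Definition simple_graph e : Prop := symmetric e /\ irreflexive e.

Definition edges e : {set {set T}} := [set [set p.1; p.2] | p : T * T & e p.1 p.2].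

Definition degree e x : nat := #|[set y | e x y]|.

(* The graph with no vertices is connected under this definition. *)
Definition connected_graph e : Prop := forall x y, connect e x y.

Definition hamiltonian_path e (s : seq T) : Prop :=
  [/\ sorted e s, uniq s & forall x, x \in s].

Definition traceable e : Prop := exists s : seq T, hamiltonian_path e s.

Definition add_edge e u v : rel T :=
  [rel x y | [|| e x y, (x == u) && (y == v) | (x == v) && (y == u)]].

Definition maximal_nontraceable e : Prop :=
  ~ traceable e /\
  forall u v, u != v -> ~~ e u v -> traceable (add_edge e u v).

End Graphs.

(* Main.v *)
Require Import Defs.
From mathcomp Require Import all_boot all_order all_algebra.
From mathcomp Require Import zify ring.

Set Implicit Arguments.
Unset Strict Implicit.
Unset Printing Implicit Defensive.

(** For nonadjacent [u <> v] in a maximal nontraceable graph, a hamiltonian path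
    of [G + uv] must use [uv], so deleting [uv] leaves two disjoint paths
    starting at [u] and at [v] that cover [G]; conversely such a pair of paths
    with [u], [v] adjacent would give a hamiltonian path of [G].  Local
    rearrangements of these pairs of paths show that a vertex [x] of degree
    different from 2 with [k x] neighbours of degree 2 has degree at least
    [k x + 3].  Since no two vertices of degree 2 are adjacent, the values [k x]
    add up to [2m], and hence [2 e(G) + m >= 3n + 2m]. *)

Section MaximalNontraceable.
Variables (T : finType) (e : rel T).
Hypothesis e_simple : simple_graph e.

Let e_sym : symmetric e := e_simple.1.
Let e_irr : irreflexive e := e_simple.2.

(** * Degree sum, cutting and joining paths *)

(** Only an inclusion: the adjacencies that a case needs are assumed separately, and a vertex found
    next to [x] on a path must be an entry of [s]. *)
Definition nbrs_in x (s : seq T) := forall z, e x z -> z \in s.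

(** Double counting of ordered adjacent pairs: the fibre over an edge [{a, b}] consists of [(a, b)]
    and [(b, a)], which differ because [e] is irreflexive. *)
Lemma sum_degree : \sum_x degree e x = 2 * #|edges e|.
Proof.
under eq_bigr => x _ do rewrite /degree -sum1dep_card.
rewrite pair_big_dep /=.
rewrite (partition_big (fun p : T * T => [set p.1; p.2]) (mem (edges e))) /=; last first.
  by move=> p ep; apply: imset_f; rewrite inE.
rewrite mulnC -sum_nat_const; apply: eq_bigr => E /imsetP[[a b] eab ->{E}] /=.
rewrite inE /= in eab.
have a'b : a != b by apply: contraTneq eab => ->; rewrite e_irr.
rewrite sum1dep_card; transitivity #|[set (a, b); (b, a)]|; last first.
  by rewrite cards2 xpair_eqE (negbTE a'b).
apply: eq_card => -[c d]; rewrite !inE /= !xpair_eqE.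
apply/andP/orP => [[ecd /eqP E]|]; last first.
  by case=> /andP[/eqP -> /eqP ->]; rewrite ?[e b a]e_sym ?eab; split=> //; rewrite setUC.
have c'd : c != d by apply: contraTneq ecd => ->; rewrite e_irr.
have ca : c \in [set a; b] by rewrite -E !inE eqxx.
have da : d \in [set a; b] by rewrite -E !inE eqxx orbT.
move: ca da; rewrite !inE => /orP[]/eqP Ec /orP[]/eqP Ed; subst c d.
all: by first [rewrite eqxx in c'd | left; rewrite !eqxx | right; rewrite !eqxx].
Qed.

(** Covers are rearranged by cutting a path at [x]; by symmetry the initial piece can be traversed
    backwards from [x]. *)
Lemma path_split a p1 x p2 : path e a (p1 ++ x :: p2) ->
  [/\ e (last a p1) x, path e x (rev (a :: p1)) & path e x p2].
Proof.
rewrite cat_path /= => /and3P[P1 E1 P2]; split=> //.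
have := rev_path e a (rcons p1 x).
rewrite last_rcons belast_rcons => ->.
rewrite (@eq_path _ (fun z => e^~ z) e) ?rcons_path ?P1 // => s t; exact: e_sym.
Qed.

Lemma join_path u v p q :
  path e u p -> path e v q -> e u v -> sorted e (rev p ++ u :: v :: q).
Proof.
elim: p u v q => [|a p IH] u v q /=; first by move=> _ -> ->.
case/andP=> ua P Q uv; rewrite rev_cons cat_rcons; apply: IH => //=.
  by rewrite uv.
by rewrite e_sym.
Qed.

(** * Covers by two disjoint paths *)

(** The single [perm_eq] with [enum T] gives both disjointness and spanning, and turns into
    equations between numbers of occurrences. *)
Definition two_path_cover u v p q :=
  [/\ path e u p, path e v q & perm_eq (enum T) ((u :: p) ++ (v :: q))].

Lemma two_path_coverC u v p q : two_path_cover u v p q -> two_path_cover v u q p.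
Proof. by case=> P Q U; split=> //; apply: perm_trans U _; rewrite perm_catC. Qed.

Lemma cover_count u v p q z : two_path_cover u v p q ->
  count_mem z (u :: p) + count_mem z (v :: q) = 1.
Proof.
case=> _ _ /permP/(_ (pred1 z)); rewrite count_cat => <-.
by rewrite count_uniq_mem ?enum_uniq // mem_enum.
Qed.

Lemma cover_mem u v p q z : two_path_cover u v p q ->
  [\/ z = u, z = v, z \in p | z \in q].
Proof.
case=> _ _ /perm_mem/(_ z); rewrite mem_enum inE mem_cat !inE.
case/esym/orP=> /orP[].
- by move/eqP; apply: Or41.
- exact: Or43.
- by move/eqP; apply: Or42.
- exact: Or44.
Qed.

Lemma cover_uniq u v p q : two_path_cover u v p q -> uniq ((u :: p) ++ (v :: q)).
Proof. by case=> _ _ U; rewrite -(perm_uniq U) enum_uniq. Qed.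

(* Concatenating the two paths gives a cycle whose only possible non-edges end at [u] and [v]. *)
Lemma cover_pred u v p q : two_path_cover u v p q ->
  exists2 pr : T -> T, injective pr & forall z, z != u -> z != v -> e (pr z) z.
Proof.
move=> C; have U := cover_uniq C; case: (C) => Pu Pv E.
set c := (u :: p) ++ (v :: q) in U E.
pose r x y := e x y || (y \in [:: u; v]).
exists (prev c) => [|z zu zv]; first exact: can_inj (next_prev U).
have sub : subrel e r by move=> x y; rewrite /r => ->.
have Cr : cycle r c.
  rewrite /c /= rcons_cat rcons_cons cat_path /= rcons_path /=.
  by rewrite (sub_path sub Pu) (sub_path sub Pv) /r !inE !eqxx !orbT.
have zc : z \in c by rewrite -(perm_mem E) mem_enum.
by have := prev_cycle Cr zc; rewrite /r !inE (negbTE zu) (negbTE zv) !orbF.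
Qed.

Hypothesis e_mnt : maximal_nontraceable e.

(** The target of the rearrangements: a case is refuted by producing a cover whose starts are
    adjacent. *)
Lemma cover_nonadj u v p q : two_path_cover u v p q -> ~~ e u v.
Proof.
move=> C; apply/negP => uv; case: e_mnt => + _; apply; case: (C) => P Q U.
exists (rev p ++ u :: v :: q); split.
- exact: join_path.
- rewrite -(perm_uniq (_ : perm_eq (enum T) _)) ?enum_uniq //.
  by apply: perm_trans U _; rewrite perm_sym -cat_rcons -rev_cons perm_cat2r perm_rev.
- move=> z; have [-> | -> | zp | zq] := cover_mem z C;
    by rewrite mem_cat !inE ?mem_rev ?eqxx ?zp ?zq ?orbT.
Qed.

Lemma cover_exists u v : u != v -> ~~ e u v -> exists p q, two_path_cover u v p q.
Proof.
move=> u'v nuv; have [s [S U M]] := e_mnt.2 _ _ u'v nuv.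
have [s1 [a [b [s2 [Es nab]]]]] : exists s1 a b s2, s = s1 ++ a :: b :: s2 /\ ~~ e a b.
  have: ~~ sorted e s by apply/negP=> S'; apply: e_mnt.1; exists s.
  elim: s {S U M} => // a [|b s] // IH /=; rewrite negb_and.
  have [ab|nab] /= := boolP (e a b); last by exists [::], a, b, s.
  by move/IH => [s1 [a' [b' [s2 [-> ?]]]]]; exists (a :: s1), a', b', s2.
(* A path of the enlarged graph that misses one end of the new edge does not use that edge. *)
have avoid c x p : (x == u) || (x == v) -> x \notin c :: p ->
    path (add_edge e u v) c p -> path e c p.
  move=> xuv; elim: p c => //= d p IH c; rewrite !inE !negb_or => /and3P[xc xd xp].
  case/andP => cd /IH -> //; last by rewrite inE negb_or xd.
  rewrite andbT; case/or3P: cd => //= /andP[/eqP E1 /eqP E2]; subst c d;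
    by case/orP: xuv xc xd => /eqP ->; rewrite eqxx.
have sym : symmetric (add_edge e u v).
  move=> x y; rewrite /add_edge /= e_sym; congr (_ || _).
  by rewrite orbC [in X in X || _]andbC [in X in _ || X]andbC.
(* The step from [a] to [b] is not an edge of [e], so it is the new edge in one of its two
   directions. *)
have {}nab : (a == u) && (b == v) || (a == v) && (b == u).
  move: S; rewrite Es; case: (s1) => [|c s1'] /=; last rewrite cat_path /=.
    by case/andP => /orP[|//]; rewrite (negbTE nab).
  by case/and3P => _ _ /andP[/orP[|//]]; rewrite (negbTE nab).
have pe : perm_eq (enum T) ((a :: rev s1) ++ b :: s2).
  apply: (@perm_trans _ s).
    by apply: uniq_perm; rewrite ?enum_uniq // => z; rewrite mem_enum M.
  by rewrite Es /= -cat_rcons perm_sym -cat_cons perm_cat2r -rev_rcons perm_rev.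
have Ue : uniq ((a :: rev s1) ++ b :: s2) by rewrite -(perm_uniq pe) enum_uniq.
have C : two_path_cover a b (rev s1) s2.
  split=> //.
  - apply: (avoid _ b).
    + by case/orP: nab => /andP[_ ->]; rewrite ?orbT.
    + by move: Ue; rewrite cat_uniq => /and3P[_ /hasPn/(_ b (mem_head _ _))].
    + have: sorted (add_edge e u v) (rcons s1 a).
        by move: S; rewrite Es -cat_rcons; case: (s1) => //= c s1'; rewrite cat_path => /andP[].
      rewrite -[path _ a _]/(sorted _ (a :: rev s1)) -rev_rcons rev_sorted.
      by rewrite (@eq_sorted _ _ (add_edge e u v)) // => x y; rewrite sym.
  - apply: (avoid _ a).
    + by case/orP: nab => /andP[->]; rewrite ?orbT.
    + by move: Ue; rewrite uniq_catC cat_uniq => /and3P[_ /hasPn/(_ a (mem_head _ _))].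
    + move: S; rewrite Es; case: (s1) => [|c s1'] /=; last rewrite cat_path /=.
        by case/andP.
      by case/and4P.
case/orP: nab => /andP[/eqP Ea /eqP Eb]; subst a b; first by exists (rev s1), s2.
by exists s2, (rev s1); apply: two_path_coverC.
Qed.

(* Closes a case in which the vertex [z] occurs twice in the cover [C]. *)
Ltac repeated C z :=
  exfalso; move: (cover_count z C); do 3 rewrite /= -?cats1 ?count_cat; rewrite /= ?eqxx /=;
  repeat match goal with
  | |- context [nat_of_bool (?a == ?b)] => move: (nat_of_bool (a == b)) => ?
  | |- context [count ?a ?b] => move: (count a b) => ?
  end; clear; lia.
(* Proves that lists have the same vertices as the cover [C], counting occurrences. *)
Ltac reorder C :=
  let f := fresh in case: (C) => _ _ /permP f;
  let g := fresh in apply/permP => g; rewrite (f g) /= ?(count_cat, count_rev) /=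
     ?(count_cat, count_rev, rev_cons, rev_rcons) -?cats1;
  do 3 rewrite /= ?(count_cat, count_rev); ring.

(** * Configurations at vertices of degree 2 excluded by rearranging a cover *)

(** On a cover starting at nonadjacent [x1] and [x2], the vertex [v] can only follow one of them
    directly and end that path. Moving [v] in front of the other start gives a cover with adjacent
    starts. *)
Lemma degree2_adj v x1 x2 : x1 != x2 -> e v x1 -> e v x2 ->
  nbrs_in v [:: x1; x2] -> e x1 x2.
Proof.
move=> x12 vx1 vx2 Nv; apply/negPn/negP => nx.
have [p [q C]] := cover_exists x12 nx.
have aux a b p' q' : two_path_cover a b p' q' -> nbrs_in v [:: a; b] ->
    e v a -> e v b -> v \in p' -> False.
  move=> {}C {}Nv va vb /path.splitPr vp; case: vp C => p1 p2 C.
  case: (C) => Pp Pq _; have [l _ P2] := path_split Pp.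
  have {l}l : last a p1 \in [:: a; b] by apply: Nv; rewrite e_sym.
  case/lastP: p1 => [|p1 t] in C Pp l; last first.
    rewrite last_rcons !inE in l.
    by case/orP: l => /eqP ?; subst t; [repeated C a | repeated C b].
  case: p2 => [|t p2] in C Pp P2; last first.
    case/andP: P2 => /Nv; rewrite !inE => /orP[]/eqP ? _; subst t; [repeated C a | repeated C b].
  have: two_path_cover a v [::] (b :: q') by split=> //=; [rewrite vb | reorder C].
  by move/cover_nonadj; rewrite e_sym va.
have [Ev|Ev|vp|vq] := cover_mem v C.
- by subst v; rewrite e_irr in vx1.
- by subst v; rewrite e_irr in vx2.
- exact: aux C _ _ _ vp.
- apply: aux (two_path_coverC C) _ _ _ vq => // z /Nv; rewrite !inE orbC //.
Qed.

(** On a cover for the nonadjacent [v] and [w], the places next to [v] and [x] are so restricted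
    that each case reroutes through the triangle [v x y] or the edge [x w]. *)
Lemma degree3_absurd v x y w : 4 <= #|T| -> x != w -> y != w -> v != w ->
  e v x -> e v y -> e x y -> e x w ->
  nbrs_in v [:: x; y] -> nbrs_in x [:: v; y; w] -> False.
Proof.
move=> n4 xw yw vw vx vy xy exw Nv Nx.
have nvw : ~~ e v w by apply/negP => /Nv; rewrite !inE [w == x]eq_sym [w == y]eq_sym (negbTE xw) (negbTE yw).
have vx' : v != x by apply: contraTneq vx => ->; rewrite e_irr.
have x'y : x != y by apply: contraTneq xy => ->; rewrite e_irr.
have [p [q C]] := cover_exists vw nvw; case: (C) => P Q U.
(* If the path from [v] is [v] alone, then [x] lies next to [y] on the path from [w]; cutting
   between them and putting [v] before [x] leaves the starts [v] and [y]. The bound 4 excludes that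
   the path is just [w x]. *)
case: p => [|z p'] in C P U *.
  have: x \in q.
    by have [E|E|//|//] := cover_mem x C; rewrite E eqxx in xw vx'.
  move=> /path.splitPr s; case: s C Q U => q1 q2 C Q U; have [l Q1 Q2] := path_split Q.
  case: q2 => [|z q2] in C Q U Q2 *; last first.
    case/andP: Q2 => /Nx + Q2; rewrite !inE => /or3P[]/eqP ?; subst z; try by repeated C v.
      have: two_path_cover v y (x :: rev (w :: q1)) q2 by split; rewrite //= ?vx //; reorder C.
      by move/cover_nonadj; rewrite vy.
    by repeated C w.
  case/lastP: q1 => [|q1 t] in C Q U l Q1 *.
    by rewrite cardE (perm_size U) in n4.
  rewrite last_rcons e_sym in l; move/Nx: l; rewrite !inE => /or3P[]/eqP ?; subst t; try by repeated C v.
    move: Q; rewrite cat_rcons => Q; have [_ Q3 _] := path_split Q.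
    have: two_path_cover v y [:: x] (rev (w :: q1)) by split; rewrite //= ?vx //; reorder C.
    by move/cover_nonadj; rewrite vy.
  by repeated C w.
case/andP: P => /Nv + P; rewrite !inE => /orP[]/eqP ?; subst z.
  case: p' => [|t p'] in C P U *.
    have: two_path_cover x w [:: v] q by split; rewrite //= 1?e_sym ?vx //; reorder C.
    by move/cover_nonadj; rewrite exw.
  case/andP: P => /Nx + P; rewrite !inE => /or3P[]/eqP ?; subst t;
    try by first [repeated C v | repeated C w].
  have: two_path_cover v x (y :: p') (w :: q) by split; rewrite //= ?vy ?exw //; reorder C.
  by move/cover_nonadj; rewrite vx.
(* The path from [v] now continues with [y], so [x] can only follow [y] or [w] directly and end its
   path. In both cases it becomes a start, followed by [w]. *)
have : (x \in p') || (x \in q).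
  have [E|E|+|->] := cover_mem x C; rewrite ?orbT //; try by rewrite E eqxx in xw vx'.
  by rewrite inE (negbTE x'y) /= => ->.
case/orP=> /path.splitPr s.
  case: s C P U => p1 p2 C P U; have [l _ P2] := path_split P.
  case/lastP: p1 => [|p1 t] in C P U l *; last first.
    rewrite last_rcons e_sym in l; move/Nx: l; rewrite !inE => /or3P[]/eqP ?; subst t;
    first [repeated C v | repeated C w | repeated C y].
  case: p2 => [|t p2] in C P U P2 *; last first.
    case/andP: P2 => /Nx; rewrite !inE => /or3P[]/eqP ? _; subst t;
    first [repeated C v | repeated C w | repeated C y].
  have: two_path_cover v x [:: y] (w :: q) by split; rewrite //= ?vy ?exw //; reorder C.
  by move/cover_nonadj; rewrite vx.
case: s C Q U => q1 q2 C Q U; have [l _ Q2] := path_split Q.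
case/lastP: q1 => [|q1 t] in C Q U l *; last first.
  rewrite last_rcons e_sym in l; move/Nx: l; rewrite !inE => /or3P[]/eqP ?; subst t;
  first [repeated C v | repeated C w | repeated C y].
case: q2 => [|t q2] in C Q U Q2 *; last first.
  case/andP: Q2 => /Nx; rewrite !inE => /or3P[]/eqP ? _; subst t;
  first [repeated C v | repeated C w | repeated C y].
have: two_path_cover v x (y :: p') [:: w] by split; rewrite //= ?vy ?exw //; reorder C.
by move/cover_nonadj; rewrite vx.
Qed.

Lemma two_triangles_absurd x v1 v2 y1 y2 : 5 <= #|T| ->
  x != v1 -> x != v2 -> v1 != v2 -> y1 != y2 -> v1 != y2 -> v2 != y1 ->
  e v1 x -> e v2 x -> e v1 y1 -> e v2 y2 ->
  nbrs_in v1 [:: x; y1] -> nbrs_in v2 [:: x; y2] ->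
  nbrs_in x [:: v1; v2; y1; y2] -> False.
Proof.
move=> n5 xv1 xv2 v12 y12 vy1 vy2 v1x v2x v1y v2y N1 N2 Nx.
(* The configuration is symmetric in the indices 1 and 2, so [x] may be taken on the path from
   [a1]. *)
have aux a1 a2 b1 b2 p q : two_path_cover a1 a2 p q -> x \in p ->
  e a1 x -> e a2 x -> e a1 b1 -> e a2 b2 ->
  nbrs_in a1 [:: x; b1] -> nbrs_in a2 [:: x; b2] ->
  nbrs_in x [:: a1; a2; b1; b2] -> False.
  move=> {v1 v2 y1 y2 xv1 xv2 v12 y12 vy1 vy2 v1x v2x v1y v2y N1 N2 Nx}
    C.
  move=> /path.splitPr s; case: s C => p1 p2 C v1x v2x v1y v2y N1 N2 Nx;
  have xv1 : e x a1 by rewrite e_sym.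
  have xv2 : e x a2 by rewrite e_sym.
  case: (C) => P Q U; have [l P1 P2] := path_split P.
  case/lastP: p1 => [|p1 t] in C P U l P1 *.
    case: q => [|z q] in C Q U *.
      case: p2 => [|t p2] in C P U P2 *.
        by rewrite cardE (perm_size U) in n5.
      case/andP: P2 => /Nx + P2; rewrite !inE => /or4P[]/eqP ?; subst t.
      - by repeated C a1.
      - by repeated C a2.
      - have: two_path_cover x a1 [:: a2] (b1 :: p2) by split; rewrite /= ?xv2 ?v1y //; reorder C.
        by move/cover_nonadj; rewrite e_sym v1x.
      - have: two_path_cover x a2 [:: a1] (b2 :: p2) by split; rewrite /= ?xv1 ?v2y //; reorder C.
        by move/cover_nonadj; rewrite e_sym v2x.
    case/andP: Q => /N2 + Q; rewrite !inE => /orP[]/eqP ?; subst z; first by repeated C x.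
    case: p2 => [|t p2] in C P U P2 *.
      have: two_path_cover x a2 [:: a1] (b2 :: q) by split; rewrite /= ?xv1 ?v2y //; reorder C.
      by move/cover_nonadj; rewrite e_sym v2x.
    case/andP: P2 => /Nx + P2; rewrite !inE => /or4P[]/eqP ?; subst t.
    - by repeated C a1.
    - by repeated C a2.
    - have: two_path_cover a1 x (b1 :: p2) [:: a2, b2 & q].
        by split; rewrite /= ?v1y ?xv2 ?v2y //; reorder C.
      by move/cover_nonadj; rewrite v1x.
    - by repeated C b2.
  rewrite last_rcons e_sym in l; move/Nx: l.
  rewrite cat_rcons in C P U; have [l P3 _] := path_split P.
  (* The successor of [a1] is [x] or [b1]; so if [b1] directly precedes [x], it also directly
     follows [a1]. *)
  have b1p1 : b1 = t -> p1 = [::].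
    move=> ?; subst t; case: p1 => [//|s p1] in C P P1 P3 U l *.
    by case/andP: P => /N1 + _; rewrite !inE => /orP[]/eqP ?; subst s; [repeated C x|repeated C b1].
  rewrite !inE => /or4P[]/eqP ?; subst t.
  - by repeated C a1.
  - by repeated C a2.
  - move: b1p1 => /(_ erefl) ?; subst p1.
    case: q => [|z q] in C Q U *.
      (* With [p2] empty there would be only the four vertices [a1], [b1], [x], [a2], against the
         bound 5. *)
      case: p2 => [|s p2] in C P U P2 *.
        by rewrite cardE (perm_size U) in n5.
      case/andP: P2 => /Nx + P2; rewrite !inE => /or4P[]/eqP ?; subst s.
      + by repeated C a1.
      + by repeated C a2.
      + by repeated C b1.
      + have: two_path_cover a2 b2 [:: x; b1; a1] p2.
          by split; rewrite /= ?v2x //; reorder C.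
        by move/cover_nonadj; rewrite v2y.
    case/andP: Q => /N2 + Q; rewrite !inE => /orP[]/eqP ?; subst z; first by repeated C x.
    case: p2 => [|s p2] in C P U P2 *.
      have: two_path_cover a1 x [:: b1] [:: a2, b2 & q].
        by split; rewrite /= ?v1y ?xv2 ?v2y //; reorder C.
      by move/cover_nonadj; rewrite v1x.
    case/andP: P2 => /Nx + P2; rewrite !inE => /or4P[]/eqP ?; subst s;
    first [repeated C a1 | repeated C a2 | repeated C b1 | repeated C b2].
  - case: q => [|z q] in C Q U *.
      have: two_path_cover b2 a2 (rev (a1 :: p1)) (x :: p2).
        by split; rewrite /= ?v2x //; reorder C.
      by move/cover_nonadj; rewrite e_sym v2y.
    case/andP: Q => /N2 + Q; rewrite !inE => /orP[]/eqP ?; subst z.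
      by repeated C x.
    by repeated C b2.
have nv : ~~ e v1 v2 by apply/negP => /N1; rewrite !inE eq_sym (negbTE xv2) (negbTE vy2).
have [p [q C]] := cover_exists v12 nv.
have [E|E|xp|xq] := cover_mem x C; try by rewrite E eqxx in xv1 xv2.
  exact: aux C xp v1x v2x v1y v2y N1 N2 Nx.
apply: aux (two_path_coverC C) xq v2x v1x v2y v1y N2 N1 _ => z /Nx.
by rewrite !inE => /or4P[] ->; rewrite ?orbT.
Qed.

(** * Vertices of degree 2 with the same two neighbours *)

(* On the cover for [a], [b] each [vi] is preceded by [x] or [y]. *)
Lemma twin_pigeonhole x y a b v1 v2 v3 : a != b -> ~~ e a b -> uniq [:: v1; v2; v3] ->
  (forall v, v \in [:: v1; v2; v3] -> [/\ v != a, v != b & nbrs_in v [:: x; y]]) -> False.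
Proof.
move=> ab nab Uv tw; have [p [q C]] := cover_exists ab nab.
have [pr prI pre] := cover_pred C.
have prN v : v \in [:: v1; v2; v3] -> pr v \in [:: x; y].
  by case/tw => va vb; apply; rewrite e_sym pre.
have sub : {subset map pr [:: v1; v2; v3] <= [:: x; y]} by move=> _ /mapP[v /prN ? ->].
by have := uniq_leq_size _ sub; rewrite map_inj_uniq //= => /(_ Uv).
Qed.

(* The cover for the nonadjacent [x], [u] contains a hamiltonian path, starting at [u],
   of the graph without [x, y, v1, v2]; the path [v1 x v2 y u] would prolong it. *)
Lemma twins_nbr v1 v2 x y u : v1 != v2 -> e v1 x -> e v1 y -> e v2 x -> e v2 y ->
  nbrs_in v1 [:: x; y] -> nbrs_in v2 [:: x; y] ->
  u != x -> u != v1 -> u != v2 -> e y u -> e x u.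
Proof.
move=> v12 v1x v1y v2x v2y N1 N2 ux uv1 uv2 yu.
have uy : u != y by apply: contraTneq yu => ->; rewrite e_irr.
apply/negPn/negP => nx; rewrite eq_sym in ux; have [p [q C]] := cover_exists ux nx.
rewrite eq_sym in ux.
(* Here [a], [b] name [v1], [v2] in the order in which they occur, the path from [x] coming
   first. *)
have aux a b : two_path_cover x u p q -> (a, b) = (v1, v2) \/ (a, b) = (v2, v1) ->
    [\/ exists p1 p2 p3, p = p1 ++ a :: p2 ++ b :: p3,
        exists p1 p2 q1 q2, p = p1 ++ a :: p2 /\ q = q1 ++ b :: q2
      | exists q1 q2 q3, q = q1 ++ a :: q2 ++ b :: q3] -> False.
  move=> {}C ab.
  have [ax [ay [bx [byy [Na Nb]]]]] : e a x /\ e a y /\ e b x /\ e b y /\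
      nbrs_in a [:: x; y] /\ nbrs_in b [:: x; y] by case: ab => -[-> ->].
  have [a'b [ua ub]] : a != b /\ u != a /\ u != b.
    by case: ab => -[-> ->]; rewrite uv1 uv2 ?[v2 == _]eq_sym v12.
  have xa : x != a by apply: contraTneq ax => ->; rewrite e_irr.
  have xb : x != b by apply: contraTneq bx => ->; rewrite e_irr.
  have ya : y != a by apply: contraTneq ay => ->; rewrite e_irr.
  have yb : y != b by apply: contraTneq byy => ->; rewrite e_irr.
  have nab : ~~ e a b by apply/negP => /Na; rewrite !inE ![b == _]eq_sym (negbTE xb) (negbTE yb).
  have nau : ~~ e a u by apply/negP => /Na; rewrite !inE (negbTE ux) (negbTE uy).
  have nbu : ~~ e b u by apply/negP => /Nb; rewrite !inE (negbTE ux) (negbTE uy).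
  (* Since [x a y b] closes up to a 4-cycle, it can be traversed from [y] instead, a neighbour of
     [u]. *)
  have fin q' : two_path_cover x u [:: a; y; b] q' -> False.
    move=> C'; case: (C') => _ Q _.
    have: two_path_cover y u [:: b; x; a] q'.
      by split; rewrite /= ?[e y b]e_sym ?[e x a]e_sym ?byy ?bx ?ax //; reorder C'.
    by move/cover_nonadj; rewrite yu.
  have twice z : z \in [:: x; y] -> z = x \/ z = y.
    by rewrite !inE => /orP[]/eqP ->; [left | right].
  case=> [[p1 [p2 [p3 Ep]]] | [p1 [p2 [q1 [q2 [Ep Eq]]]]] | [q1 [q2 [q3 Eq]]]].
  - subst p; case: (C) => P Q U; have [l _ P2] := path_split P; have [k _ P3] := path_split P2.
    case/lastP: p2 => [|p2 t] in C P P2 U l k *; first by rewrite /= (negbTE nab) in k.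
    rewrite last_rcons e_sym in k.
    case/Nb/twice: k => ?; subst t; first by repeated C x.
    case/lastP: p1 => [|p1 s] in C P U l *; last first.
      rewrite last_rcons e_sym in l.
      by case/Na/twice: l => ?; subst s; [repeated C x | repeated C y].
    case: p2 => [|s p2] in C P P2 U *; last first.
      by case/andP: P2 => /Na/twice[] ? _; subst s; [repeated C x | repeated C y].
    case: p3 => [|s p3] in C P P2 P3 U *; last first.
      by case/andP: P3 => /Nb/twice[] ? _; subst s; [repeated C x | repeated C y].
    exact: fin C.
  - subst p q; case: (C) => P Q U; have [l _ P2] := path_split P; have [k _ Q2] := path_split Q.
    case/lastP: q1 => [|q1 t] in C Q U k *; first by rewrite e_sym (negbTE nbu) in k.
    rewrite last_rcons e_sym in k.
    case/Nb/twice: k => ?; subst t; first by repeated C x.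
    case/lastP: p1 => [|p1 s] in C P U l *; last first.
      rewrite last_rcons e_sym in l.
      by case/Na/twice: l => ?; subst s; [repeated C x | repeated C y].
    case: p2 => [|s p2] in C P P2 U *; last first.
      by case/andP: P2 => /Na/twice[] ? _; subst s; [repeated C x | repeated C y].
    case: q2 => [|s q2] in C Q Q2 U *; last first.
      by case/andP: Q2 => /Nb/twice[] ? _; subst s; [repeated C x | repeated C y].
    rewrite cat_rcons in Q; have {}Q : path e u q1 by move: Q; rewrite cat_path => /andP[].
    have: two_path_cover y u [:: b; x; a] q1.
      by split; rewrite /= ?[e y b]e_sym ?[e x a]e_sym ?byy ?bx ?ax //; reorder C.
    by move/cover_nonadj; rewrite yu.
  (* With both twins on the path from [u], each needs a predecessor among [x] and [y]; but [x] is on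
     the other path, and [y] can serve only one of them. *)
  - subst q; case: (C) => P Q U; have [l _ Q2] := path_split Q; have [k _ Q3] := path_split Q2.
    case/lastP: q1 => [|q1 t] in C Q U l *; first by rewrite e_sym (negbTE nau) in l.
    rewrite last_rcons e_sym in l.
    case/Na/twice: l => ?; subst t; first by repeated C x.
    case/lastP: q2 => [|q2 s] in C Q Q2 U k *; first by rewrite /= (negbTE nab) in k.
    rewrite last_rcons e_sym in k.
    by case/Nb/twice: k => ?; subst s; [repeated C x | repeated C y].
have v21 : v2 != v1 by rewrite eq_sym.
have v1x' : v1 != x by apply: contraTneq v1x => ->; rewrite e_irr.
have v2x' : v2 != x by apply: contraTneq v2x => ->; rewrite e_irr.
have o12 := or_introl (erefl (v1, v2)) : (v1, v2) = (v1, v2) \/ (v1, v2) = (v2, v1).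
have o21 := or_intror (erefl (v2, v1)) : (v2, v1) = (v1, v2) \/ (v2, v1) = (v2, v1).
have two (z t : T) (s : seq T) : z != t -> z \in s -> t \in s ->
    (exists s1 s2 s3, s = s1 ++ z :: s2 ++ t :: s3) \/
    (exists s1 s2 s3, s = s1 ++ t :: s2 ++ z :: s3).
  move=> zt /path.splitPr[s1 s2]; rewrite mem_cat inE eq_sym (negbTE zt) /=.
  case/orP=> /path.splitPr[s3 s4]; last by left; exists s1, s3, s4.
  by right; exists s3, s4, s2; rewrite -catA.
have [E|E|v1p|v1q] := cover_mem v1 C; try by rewrite E eqxx in uv1 v1x'.
  have [E|E|v2p|v2q] := cover_mem v2 C; try by rewrite E eqxx in uv2 v2x'.
    by case: (two _ _ _ v12 v1p v2p) => D; [apply: aux C o12 _ | apply: aux C o21 _]; apply: Or31.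
  apply: aux C o12 _; apply: Or32.
  by case/path.splitPr: v1p => p1 p2; case/path.splitPr: v2q => q1 q2; exists p1, p2, q1, q2.
have [E|E|v2p|v2q] := cover_mem v2 C; try by rewrite E eqxx in uv2 v2x'.
  apply: aux C o21 _; apply: Or32.
  by case/path.splitPr: v2p => p1 p2; case/path.splitPr: v1q => q1 q2; exists p1, p2, q1, q2.
by case: (two _ _ _ v12 v1q v2q) => D; [apply: aux C o12 _ | apply: aux C o21 _]; apply: Or33.
Qed.

(** By [side] the set [A] can be left only through [w]; symmetry of [e] turns this into the same
    restriction on entering [A]. *)
Lemma path_side (A : seq T) w a q :
  (forall s t, e s t -> s \in A -> t != w -> t \in A) -> w \notin A ->
  path e a q -> w \notin a :: q -> {in q, forall z, (z \in A) = (a \in A)}.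
Proof.
move=> side wA; elim: q a => //= b q IH a /andP[ab Pq].
rewrite !inE !negb_or => /and3P[wa wb wq] z.
have ba : (b \in A) = (a \in A).
  apply/idP/idP => [bA|aA]; last by apply: side ab aA _; rewrite eq_sym.
  by apply: (side b) bA _; rewrite 1?e_sym // eq_sym.
rewrite inE => /orP[/eqP -> //|zq]; rewrite -ba; apply: IH => //.
by rewrite inE negb_or wb.
Qed.

(* Here [w] separates [x, v1, y, v2] from the rest, so on the cover for [v1], [w] the path
   starting at [w] visits all of the rest; [v2 y v1 x w] prolongs it to a hamiltonian path. *)
Lemma twins_degree4_absurd v1 v2 x y w u : uniq [:: x; v1; y; v2; w; u] ->
  e v1 x -> e v1 y -> e v2 y -> e x w ->
  nbrs_in v1 [:: x; y] -> nbrs_in v2 [:: x; y] ->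
  nbrs_in x [:: v1; v2; y; w] -> nbrs_in y [:: v1; v2; x; w] -> False.
Proof.
move=> U v1x v1y v2y xw N1 N2 Nx Ny.
pose A := [:: x; v1; y; v2].
have UA : uniq A.
  by move: U; rewrite -[_ :: _]/(A ++ [:: w; u]) cat_uniq => /andP[].
have /norP[wA /norP[uA _]] : ~~ has (mem A) [:: w; u].
  by move: U; rewrite -[_ :: _]/(A ++ [:: w; u]) cat_uniq => /and3P[].
rewrite /= in wA uA.
have wu : w != u.
  by move: U => /= /and5P[_ _ _ _]; rewrite !inE => /andP[].
have side s t : e s t -> s \in A -> t != w -> t \in A.
  move=> + + tw; rewrite !inE => + /or4P[]/eqP ?; subst s => st.
  - by move/Nx: st; rewrite !inE (negbTE tw) orbF => /or3P[] ->; rewrite /= ?orbT.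
  - by move/N1: st; rewrite !inE => /orP[] ->; rewrite /= ?orbT.
  - by move/Ny: st; rewrite !inE (negbTE tw) orbF => /or3P[] ->; rewrite /= ?orbT.
  - by move/N2: st; rewrite !inE => /orP[] ->; rewrite /= ?orbT.
have v1A : v1 \in A by rewrite !inE eqxx orbT.
have v1w : v1 != w by apply: contraNneq wA => <-.
have nvw : ~~ e v1 w.
  by apply: contra wA => /N1; rewrite !inE => /orP[] ->; rewrite /= ?orbT.
have [p [q C]] := cover_exists v1w nvw; case: (C) => P Q E.
have wp : w \notin v1 :: p.
  by move: (cover_uniq C); rewrite cat_uniq /= => /and3P[_ /norP[]].
have wq : w \notin q by move: (cover_uniq C); rewrite cat_uniq /= => /and4P[].
have pA := path_side side wA P wp.
(* The path from [v1] stays in [A], so the outside vertex [u] lies on the path from [w]; hence [q]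
   is nonempty and, staying on the side of [u], avoids [A]. *)
have up : u \notin p by apply: contra uA => /pA ->.
have uq : u \in q.
  have [Eu|Eu|up'|//] := cover_mem u C; first by rewrite Eu v1A in uA.
    by rewrite Eu eqxx in wu.
  by rewrite up' in up.
case: q => [//|z q] in C Q E wq uq *.
case/andP: (Q) => _ Qz; have qA := path_side side wA Qz wq.
have zA : (z \in A) = false.
  by apply/negbTE; move: uq uA; rewrite inE => /orP[/eqP ->|/qA ->].
have: two_path_cover x w [:: v1; y; v2] (z :: q).
  split=> //; first by rewrite /= e_sym v1x v1y e_sym v2y.
  apply: uniq_perm; rewrite ?enum_uniq //.
    rewrite (cat_uniq A) UA andTb; apply/andP; split.
      apply/hasPn => t; rewrite inE => /orP[/eqP -> //|].
      rewrite inE => /orP[/eqP ->|/qA tA]; apply: negbT; first exact: zA.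
      exact: etrans tA zA.
    by have := cover_uniq C; rewrite cat_uniq => /and3P[].
  move=> t; rewrite mem_enum mem_cat -[x :: _]/A.
  have [->|->|/pA ->|tq] := cover_mem t C; rewrite ?v1A ?inE ?eqxx ?orbT //.
  by rewrite inE in tq; rewrite tq !orbT.
by move/cover_nonadj; rewrite xw.
Qed.

(** * The lower bound on degrees *)

Hypothesis e_connected : connected_graph e.
Hypothesis order_ge7 : 7 <= #|T|.
Hypothesis no_degree1 : forall x, degree e x <> 1.
Hypothesis no_adjacent_degree2 : forall x y, e x y -> ~ (degree e x = 2 /\ degree e y = 2).

Lemma degree_gt0 x : 0 < degree e x.
Proof.
have [y yx] : exists y, y != x.
  have : 0 < #|[set~ x]| by have := cardsC1 x; lia.
  by case/card_gt0P => y; rewrite !inE; exists y.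
have /connectP[[|z p] /= P Ey] := e_connected x y; first by rewrite Ey eqxx in yx.
by case/andP: P => xz _; apply/card_gt0P; exists z; rewrite inE.
Qed.

(** The triangle [x v y] is closed by [degree2_adj]. *)
Lemma degree2_partner x v : e x v -> degree e v = 2 ->
  exists y, [/\ e v y, nbrs_in v [:: x; y], x != y, e x y & degree e y != 2].
Proof.
move=> xv dv; have vx : e v x by rewrite e_sym.
have /eqP/cards1P[y Ey] : #|[set z | e v z] :\ x| = 1.
  by have := cardsD1 x [set z | e v z]; rewrite inE vx -/(degree e v) dv; lia.
have /setD1P[yx] : y \in [set z | e v z] :\ x by rewrite Ey set11.
rewrite inE => vy; rewrite eq_sym in yx.
have Nv : nbrs_in v [:: x; y].
  move=> z vz; rewrite !inE; case: eqP => //= /eqP zx.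
  by have := in_set1 z y; rewrite -Ey !inE zx vz => <-.
exists y; split=> //; first exact: (degree2_adj yx vx vy Nv).
by apply/eqP => dy; apply: no_adjacent_degree2 vy _.
Qed.

(** Three twins away from a nonadjacent pair contradict [twin_pigeonhole]. The pair is [x] with a
    non-neighbour or, if [x] is adjacent to all other vertices, two of the twins. *)
Lemma many_twins_absurd x y (s : seq T) : uniq s -> 3 <= size s ->
  (forall v, v \in s -> e x v /\ nbrs_in v [:: x; y]) ->
  (forall z, e x z -> z \in y :: s) -> y \notin s -> False.
Proof.
move=> Us s3 Ns Nx ys.
have ne v : v \in s -> v != x.
  by case/Ns => xv _; apply: contraTneq xv => ->; rewrite e_irr.
have pigeon a b (t : seq T) : a != b -> ~~ e a b -> uniq t -> 3 <= size t ->
    {subset t <= s} -> (forall v, v \in t -> v != a /\ v != b) -> False.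
  case: t => [|v1 [|v2 [|v3 t]]] // ab nab Ut _ ts tab.
  have sub : {subset [:: v1; v2; v3] <= [:: v1, v2, v3 & t]}.
    by move=> v; rewrite !inE => /or3P[] ->; rewrite ?orbT.
  apply: (twin_pigeonhole (x := x) (y := y) ab nab (v1 := v1) (v2 := v2) (v3 := v3)).
    by move: Ut; rewrite -[_ :: _]/([:: v1; v2; v3] ++ t) cat_uniq => /andP[].
  move=> v /sub vt; have [va vb] := tab v vt.
  by have [_ Nv] := Ns v (ts v vt).
have [/existsP[u /andP[ux nxu]]|] := boolP [exists u, (u != x) && ~~ e x u].
  apply: (pigeon x u s) => //; first by rewrite eq_sym.
  move=> v vs; split; first exact: ne.
  by apply: contraNneq nxu => <-; case: (Ns v vs).
rewrite negb_exists => /forallP all_nbrs.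
(* All vertices are now among [x], [y] and [s], so order 7 gives five twins: two for the pair and
   three for the pigeonhole. *)
have : #|T| <= size [:: x, y & s].
  rewrite cardE; apply: uniq_leq_size (enum_uniq _) _ => z _; rewrite inE.
  have := all_nbrs z; case: eqP => //= _; rewrite negbK; exact: Nx.
move/(leq_trans order_ge7) => {s3}/=.
case: s Us Ns Nx ys ne pigeon => [|a [|b t]] // Us Ns _ ys ne pigeon s5.
move: (Us) => /= /and3P[]; rewrite inE negb_or => /andP[ab at'] bt Ut.
apply: (pigeon a b t) => //.
- have [_ Na] := Ns a (mem_head _ _); apply/negP => /Na; rewrite !inE.
  have bs : b \in [:: a, b & t] by rewrite !inE eqxx orbT.
  rewrite (negbTE (ne b bs)) /= => /eqP E; by rewrite -E bs in ys.
- by move=> v vt; rewrite !inE vt !orbT.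
- by move=> v vt; split; [apply: contraNneq at' => <-|apply: contraNneq bt => <-].
Qed.

(** The neighbourhoods of [x] and [y] are pinned down to those in [twins_degree4_absurd]: by
    [twins_nbr] the two share their further neighbours, and the pigeonhole leaves no third twin. *)
Lemma twins_absurd v1 v2 x y w : v1 != v2 ->
  e x v1 -> degree e v1 = 2 -> nbrs_in v1 [:: x; y] ->
  e x v2 -> degree e v2 = 2 -> nbrs_in v2 [:: x; y] ->
  e x w -> degree e w <> 2 -> y != w ->
  (forall z, e x z -> [\/ degree e z = 2, z = y | z = w]) -> False.
Proof.
move=> v12 xv1 d1 N1 xv2 d2 N2 xw dw yw Nx.
have eN v : e x v -> degree e v = 2 -> nbrs_in v [:: x; y] -> e v y /\ degree e y != 2 /\ x != y /\ e x y.
  move=> xv dv Nv; have [y' [vy' N' xy' xyy' dy']] := degree2_partner xv dv.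
  have := Nv _ vy'; rewrite !inE eq_sym (negbTE xy') /= => /eqP E.
  by rewrite -E.
have [v1y [dy [xy exy]]] := eN _ xv1 d1 N1.
have [v2y _] := eN _ xv2 d2 N2.
have v1x : e v1 x by rewrite e_sym.
have v2x : e v2 x by rewrite e_sym.
have neq a b : e a b -> a != b by apply: contraTneq => ->; rewrite e_irr.
have flip v : nbrs_in v [:: x; y] -> nbrs_in v [:: y; x].
  by move=> N z /N; rewrite !inE orbC.
(* With [x] and [y] exchanged, [twins_nbr] makes [z] adjacent to [y], so [z] is a further twin. *)
have tN z : e x z -> degree e z = 2 -> nbrs_in z [:: x; y].
  move=> xz dz; have [->//|zv1] := eqVneq z v1; have [->//|zv2] := eqVneq z v2.
  have yz : e y z.
    apply: (twins_nbr v12 v1y v1x v2y v2x (flip _ N1) (flip _ N2)) => //.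
    by apply: contraNneq dy => <-; rewrite dz.
  have [y' [_ N' _ _ _]] := degree2_partner xz dz.
  have := N' y; rewrite e_sym yz !inE eq_sym (negbTE xy) /= => /(_ isT)/eqP ->.
  exact: N'.
(* The degree of [w] is at least 3, so [w] has a neighbour besides [x] and [y]. *)
have [u wu [ux uy]] : exists2 u, e w u & u != x /\ u != y.
  have : 0 < #|[set z | e w z] :\ x :\ y|.
    have := cardsD1 y ([set z | e w z] :\ x); have := cardsD1 x [set z | e w z].
    rewrite -/(degree e w); have := degree_gt0 w; have := @no_degree1 w.
    by case: (x \in _) (y \in _) => -[]; move: dw; clear; lia.
  by case/card_gt0P => u; rewrite !inE => /and3P[uy ux wu]; exists u.
have uw : u != w by rewrite eq_sym neq.
have nxu : ~~ e x u.
  apply/negP => xu; have [du|Eu|Eu] := Nx u xu.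
  - have := tN u xu du w; rewrite e_sym wu !inE => /(_ isT).
    by rewrite eq_sym (negbTE (neq _ _ xw)) eq_sym (negbTE yw).
  - by rewrite Eu eqxx in uy.
  - by rewrite Eu eqxx in uw.
have nbr_ne v : e x v -> v != x /\ v != u.
  by move=> xv; split; [rewrite eq_sym neq | apply: contraTneq xv => ->].
have third z : e x z -> degree e z = 2 -> z \in [:: v1; v2].
  move=> xz dz; apply/negPn/negP; rewrite !inE negb_or => /andP[z1 z2].
  have xu : x != u by rewrite eq_sym.
  apply: (twin_pigeonhole (x := x) (y := y) (v1 := z) (v2 := v1) (v3 := v2) xu nxu).
    by rewrite /= !inE negb_or z1 z2 v12.
  move=> v; rewrite !inE => /or3P[]/eqP ->;
    by [case: (nbr_ne _ xz); split=> //; apply: tN | case: (nbr_ne _ xv1)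
       | case: (nbr_ne _ xv2)].
have Nx' : nbrs_in x [:: v1; v2; y; w].
  move=> z xz; have [dz|->|->] := Nx z xz; rewrite ?inE ?eqxx ?orbT //.
  by move: (third z xz dz); rewrite !inE => /orP[] ->; rewrite ?orbT.
have Ny : nbrs_in y [:: v1; v2; x; w].
  move=> z yz; rewrite !inE; apply/negPn/negP; rewrite !negb_or => /and4P[z1 z2 zx zw].
  have xz : e x z.
    exact: (twins_nbr v12 v1x v1y v2x v2y N1 N2 zx z1 z2 yz).
  have := Nx' z xz; rewrite !inE (negbTE z1) (negbTE z2) (negbTE zw) orbF /= => /eqP E.
  by rewrite E e_irr in yz.
apply: (twins_degree4_absurd (u := u) _ v1x v1y v2y xw N1 N2 Nx' Ny).
have [_ u1] := nbr_ne _ xv1; have [_ u2] := nbr_ne _ xv2.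
have w1 : v1 != w by apply/eqP => E; apply: dw; rewrite -E.
have w2 : v2 != w by apply/eqP => E; apply: dw; rewrite -E.
rewrite /= !inE !negb_or (neq _ _ xv1) xy (neq _ _ xv2) (neq _ _ xw) [x == u]eq_sym ux.
rewrite (neq _ _ v1y) v12 w1 u1 [y == v2]eq_sym (neq _ _ v2y) yw [y == u]eq_sym uy.
by rewrite w2 u2 [w == u]eq_sym uw.
Qed.

(** Let [D] and [B] be the neighbours of degree 2 and the others; the claim is that [B] has at least
    3 elements. Otherwise [D] is nonempty, and the partner of each of its vertices lies in [B]. *)
Lemma degree_ge x : degree e x <> 2 ->
  3 + #|[set v | e x v && (degree e v == 2)]| <= degree e x.
Proof.
move=> dx; set D := [set v | _].
pose B := [set v | e x v && (degree e v != 2)].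
have dDB : degree e x = #|D| + #|B|.
  rewrite /degree -(cardsID [set v | degree e v == 2]); congr (_ + _); apply: eq_card => v.
    by rewrite !inE.
  by rewrite !inE andbC.
rewrite dDB addnC leq_add2l ltnNge; apply/negP => B2.
have inD v : v \in enum D -> e x v /\ degree e v = 2.
  by rewrite mem_enum inE => /andP[? /eqP].
have inB v : v \in B -> e x v /\ degree e v <> 2.
  by rewrite inE => /andP[? /eqP].
have Nx z : e x z -> z \in enum D \/ z \in B.
  by move=> xz; rewrite mem_enum !inE xz /=; case: eqP; [left|right].
have UD : uniq (enum D) := enum_uniq _.
have x_ne z : e x z -> x != z by apply: contraTneq => ->; rewrite e_irr.
have d4 v w y : e x v -> degree e v = 2 -> nbrs_in v [:: x; y] -> e v y -> e x y ->
    y != w -> v != w -> e x w -> nbrs_in x [:: v; y; w] -> False.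
  move=> xv dv Nv vy xy yw vw xw Nx'.
  apply: (degree3_absurd (v := v) (x := x) (y := y) (w := w)) => //.
  - by apply: leq_trans order_ge7.
  - exact: x_ne.
  - by rewrite e_sym.
have szD : size (enum D) = #|D| by rewrite cardE.
have n0 := degree_gt0 x; have n1 := @no_degree1 x.
have : 0 < #|D| by rewrite lt0n; apply/eqP => D0; lia.
case/card_gt0P => v1 v1D.
have {v1D}v1D : v1 \in enum D by rewrite mem_enum.
have [xv1 d1] := inD v1 v1D.
have [y [v1y N1 x'y xy dy]] := degree2_partner xv1 d1.
have yB : y \in B by rewrite inE xy dy.
(* If [B] is just [{y}], all of [D] are twins: two of them fall under [degree3_absurd], more under
   [many_twins_absurd]. *)
have [w1|] := leqP #|B| 1.
  have EB z : z \in B -> z = y.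
    by move=> zB; apply: (card_le1_eqP w1).
  have twins v : v \in enum D -> e x v /\ nbrs_in v [:: x; y].
    case/inD => xv dv; have [y' [_ Nv _ xy' dy']] := degree2_partner xv dv.
    by split=> //; rewrite -(EB y') // inE xy' dy'.
  have Nx' z : e x z -> z \in y :: enum D.
    by case/Nx => [zD|/EB ->]; rewrite inE ?zD ?orbT ?eqxx.
  apply: (@many_twins_absurd x y (enum D)) => //; last first.
    by apply/negP => /inD[_ d]; rewrite d in dy.
  have : 2 <= size (enum D) by lia.
  case: (enum D) UD inD twins Nx' => [|a [|b [|c s]]] //= Us inD' twins Nx' _.
  have aD : a \in [:: a; b] by rewrite mem_head.
  have bD : b \in [:: a; b] by rewrite !inE eqxx orbT.
  have [xa da] := inD' a aD; have [xb db] := inD' b bD.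
  have [_ Na] := twins a aD.
  have [y' [ay' Na' _ xy' dy']] := degree2_partner xa da.
  have Ey' : y' = y by apply: EB; rewrite inE xy' dy'.
  subst y'.
  have ab : a != b by move: Us; rewrite inE andbT.
  have yb : y != b by apply: contraNneq dy => ->; rewrite db.
  case: (d4 a b y xa da Na ay' xy yb ab xb) => z /Nx'; rewrite !inE.
  by case/or3P=> ->; rewrite ?orbT.
move=> B1; have {B1 B2}B2 : #|B| = 2 by apply/eqP; rewrite eqn_leq B2.
have /eqP/cards1P[w Ew] : #|B :\ y| = 1.
  by have := cardsD1 y B; rewrite yB B2; lia.
have /setD1P[wy wB] : w \in B :\ y by rewrite Ew set11.
have [xw dw] := inB w wB.
have EB z : z \in B -> z = y \/ z = w.
  move=> zB; have [->|zy] := eqVneq z y; [by left | right].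
  by have : z \in B :\ y; [rewrite in_setD1 zy | rewrite Ew => /set1P].
(* With [B = {y, w}] each vertex of [D] has partner [y] or [w], and [twins_absurd] allows at most
   one of each type. A single vertex falls under [degree3_absurd], one of each under
   [two_triangles_absurd]. *)
have type v : v \in enum D ->
    nbrs_in v [:: x; y] /\ e v y \/ nbrs_in v [:: x; w] /\ e v w.
  case/inD => xv dv; have [y' [vy' Nv _ xy' dy']] := degree2_partner xv dv.
  have /EB[E|E] : y' \in B by rewrite inE xy' dy'.
    by left; rewrite -E.
  by right; rewrite -E.
have yw : y != w by rewrite eq_sym.
have dneq a b : degree e a = 2 -> b \in B -> a != b.
  by move=> da /inB[_ db]; apply/eqP => E; apply: db; rewrite -E.
have sameY a b : a \in enum D -> b \in enum D -> a != b ->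
    nbrs_in a [:: x; y] -> nbrs_in b [:: x; y] -> False.
  move=> /inD[xa da] /inD[xb db] ab Na Nb.
  apply: (@twins_absurd a b x y w) => // z xz.
  by have [/inD[_ dz]|/EB[->|->]] := Nx z xz; [apply: Or31|apply: Or32|apply: Or33].
have sameW a b : a \in enum D -> b \in enum D -> a != b ->
    nbrs_in a [:: x; w] -> nbrs_in b [:: x; w] -> False.
  move=> /inD[xa da] /inD[xb db] ab Na Nb.
  apply: (@twins_absurd a b x w y) => // [|z xz]; first exact/eqP.
  by have [/inD[_ dz]|/EB[->|->]] := Nx z xz; [apply: Or31|apply: Or33|apply: Or32].
have triangles a b : enum D =i [:: a; b] -> a != b ->
    nbrs_in a [:: x; y] /\ e a y -> nbrs_in b [:: x; w] /\ e b w -> False.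
  move=> ED ab [Na ay] [Nb bw].
  have [xa da] : e x a /\ degree e a = 2 by apply: inD; rewrite ED mem_head.
  have [xb db] : e x b /\ degree e b = 2 by apply: inD; rewrite ED !inE eqxx orbT.
  apply: (two_triangles_absurd (x := x) (v1 := a) (v2 := b) (y1 := y) (y2 := w)) => //.
  - by apply: leq_trans order_ge7.
  - exact: x_ne.
  - exact: x_ne.
  - exact: dneq.
  - exact: dneq.
  - by rewrite e_sym.
  - by rewrite e_sym.
  - move=> z /Nx[|/EB[]->]; rewrite ?ED !inE ?eqxx ?orbT //.
    by case/orP => ->; rewrite ?orbT.
case ED : (enum D) => [|a [|b s]]; first by rewrite ED in v1D.
  have := v1D; rewrite ED inE => /eqP E; subst a.
  apply: (d4 v1 w y xv1 d1 N1 v1y xy yw (dneq _ _ d1 wB) xw) => z /Nx[|/EB[]->].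
  - by rewrite ED !inE => /eqP ->; rewrite eqxx.
  - by rewrite !inE eqxx orbT.
  - by rewrite !inE eqxx !orbT.
have aD : a \in enum D by rewrite ED mem_head.
have bD : b \in enum D by rewrite ED !inE eqxx orbT.
have ab : a != b by move: UD; rewrite ED /= inE negb_or => /andP[/andP[]].
have ba : b != a by rewrite eq_sym.
have [Ta|Ta] := type a aD; have [Tb|Tb] := type b bD.
- exact: sameY aD bD ab Ta.1 Tb.1.
- case: s ED => [ED|c s ED]; first by apply: triangles ab Ta Tb; rewrite ED.
  have cD : c \in enum D by rewrite ED !inE eqxx !orbT.
  have [ac bc] : a != c /\ b != c.
    by move: UD; rewrite ED /= !inE !negb_or -!andbA => /and5P[_ ? _ ? _].
  by have [Tc|Tc] := type c cD; [apply: sameY aD cD ac Ta.1 Tc.1 | apply: sameW bD cD bc Tb.1 Tc.1].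
- case: s ED => [ED|c s ED].
    by apply: triangles ba Tb Ta => z; rewrite ED !inE orbC.
  have cD : c \in enum D by rewrite ED !inE eqxx !orbT.
  have [ac bc] : a != c /\ b != c.
    by move: UD; rewrite ED /= !inE !negb_or -!andbA => /and5P[_ ? _ ? _].
  by have [Tc|Tc] := type c cD; [apply: sameY bD cD bc Tb.1 Tc.1 | apply: sameW aD cD ac Ta.1 Tc.1].
- exact: sameW aD bD ab Ta.1 Tb.1.
Qed.

End MaximalNontraceable.

(** * Summing the degree bounds *)

Import Order.TTheory GRing.Theory Num.Theory.

Theorem theorem8 (T : finType) (e : rel T) (n m : nat)
  (e_simple : simple_graph e)
  (e_connected : connected_graph e)
  (e_mnt : maximal_nontraceable e)
  (order_n : #|T| = n)
  (n_ge7 : 7 <= n)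
  (no_degree1 : forall x : T, degree e x <> 1)
  (no_adjacent_degree2 :
     forall x y : T, e x y -> ~ (degree e x = 2 /\ degree e y = 2))
  (m_degree2 : #|[set x : T | degree e x == 2]| = m) :
  (2^-1 * (3 * n%:R + m%:R) <= #|edges e|%:R :> rat)%R.
Proof.
have e_sym := e_simple.1.
suff bound : 3 * n + m <= 2 * #|edges e|.
  rewrite ler_pdivrMl ?ltr0n //.
  by rewrite -!natrM -natrD ler_nat.
pose k x := #|[set v | e x v && (degree e v == 2)]|.
(* For a vertex of degree 2, [k x] is 0 and the added 1 makes up for the missing degree. *)
have le x : 3 + k x <= degree e x + (degree e x == 2).
  case: eqP => [dx|/degree_ge]; last first.
    by rewrite addn0; apply=> //; rewrite order_n.
  rewrite dx /k (_ : [set v | _] = set0) ?cards0 //; apply/setP => v; rewrite !inE.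
  by apply/andP => -[xv /eqP dv]; apply: no_adjacent_degree2 xv _.
(* Exchanging the sums counts each vertex of degree 2 once for each of its two neighbours. *)
have sumk : \sum_x k x = 2 * m.
  rewrite /k; under eq_bigr => x _ do rewrite -sum1dep_card.
  rewrite (exchange_big_dep (fun v => degree e v == 2)) /=; last by move=> x v _ /andP[].
  rewrite -m_degree2 mulnC -sum_nat_const.
  rewrite (eq_bigl (fun v => v \in [set x | degree e x == 2])); last by move=> v; rewrite inE.
  apply: eq_bigr => v; rewrite inE => /[dup] dv /eqP {2}<-.
  rewrite sum1dep_card /degree; apply: eq_card => x.
  by rewrite !inE dv andbT e_sym.
have sum2 : \sum_x (degree e x == 2 : nat) = m.
  rewrite -m_degree2 -sum1dep_card [RHS]big_mkcond /=; apply: eq_bigr => x _.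
  by case: (degree e x == 2).
have : \sum_x (3 + k x) <= \sum_x (degree e x + (degree e x == 2)).
  by apply: leq_sum => x _; apply: le.
rewrite !big_split /= sumk sum2 (sum_degree e_simple) sum_nat_const.
rewrite order_n; move: #|edges e| => E.
clear; lia.
Qed.
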